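(* In the non-preemptive mUETS problem, the following online algorithm is $O(\sqrt{m})$-competitive (i.e., there is an absolute constant $C$ such that its makespan is at most $C\sqrt{m}$ times the optimal makespan on every instance): let $k=\lfloor\sqrt m\rfloor$; compute a partition $(X_1,\dots,X_k)$ of $J$ into $k$ (possibly empty) parts minimizing $\max_{i\in[k]}c(X_i)$; assign each batch $X_i$, $i\in[k]$, to its own set of $\lfloor m/k\rfloor$ machines.
   Context: Non-preemptive mUETS: a finite set $J$ of $n$ jobs and $m$ identical machines, $n\ge m\ge 2$, all jobs available at time $0$. A known setup-time function $c:2^J\to\mathbb{R}_{\ge0}$ is monotone ($c(X)\le c(Y)$ for $X\subseteq Y$) and subadditive ($c(X)+c(Y)\ge c(X\cup Y)$ for disjoint $X,Y$). Each job $j$ has execution time $p_j\ge0$, unknown to an online algorithm until $j$ completes; $p(X)=\sum_{j\in X}p_j$. An algorithm forms batches (sets of jobs not completed and not assigned elsewhere) and may assign a batch $X$ to $k\ge1$ idle machines; each of these machines incurs setup time $c(X)$ and the jobs of $X$ are executed first-come first-served among them, so the batch is completed between $c(X)+p(X)/k$ and $c(X)+p(X)/k+\max_{j\in X}p_j$ time units after it starts. Batches are processed to completion without interruption. The makespan is the completion time of all jobs. The optimal makespan is $\min_{(X_1,\dots,X_m)\text{ partition of }J}\max_i(c(X_i)+p(X_i))$. An algorithm is $\rho$-competitive if its makespan is at most $\rho$ times the optimal makespan on every instance. *)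

(* Defs.v *)
From mathcomp Require Import all_boot all_order all_algebra.
From mathcomp Require Import reals.
Import Order.TTheory GRing.Theory Num.Theory.

Set Implicit Arguments.
Unset Strict Implicit.
Unset Printing Implicit Defensive.

Local Open Scope ring_scope.

(* [m] machines, setup-time function [c], execution times [p]. *)
Record mUETS_instance (R : realType) (m : nat) (J : finType)
    (c : {set J} -> R) (p : J -> R) : Prop := MUETSInstance {
  machines_ge2 : (2 <= m)%N;
  machines_le_jobs : (m <= #|J|)%N;
  setup_ge0 : forall X : {set J}, 0 <= c X;
  setup_mono : forall X Y : {set J}, X \subset Y -> c X <= c Y;
  setup_subadd : forall X Y : {set J},
    [disjoint X & Y] -> c (X :|: Y) <= c X + c Y;
  exec_ge0 : forall j : J, 0 <= p j
}.

(* An ordered partition of [J] into [k] possibly empty parts is encoded by the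
   map sending each job to the index of its part. *)
Definition part (J : finType) (k : nat) (f : {ffun J -> 'I_k}) (i : 'I_k) :
    {set J} :=
  [set j | f j == i].

Definition minimizes (T : Type) (R : realType) (F : T -> R) (x : T) : Prop :=
  forall y : T, F x <= F y.

(* All the maxima below are over nonnegative quantities, so that the default
   value 0 only matters for an empty range. *)
Definition partition_makespan (R : realType) (m : nat) (J : finType)
    (c : {set J} -> R) (p : J -> R) (f : {ffun J -> 'I_m}) : R :=
  \big[Num.max/0]_(i < m) (c (part f i) + \sum_(j in part f i) p j).

Definition optimal_makespan (R : realType) (m : nat) (J : finType)
    (c : {set J} -> R) (p : J -> R) (opt : R) : Prop :=
  exists f : {ffun J -> 'I_m},
    minimizes (partition_makespan c p) f /\ opt = partition_makespan c p f.

(* [idle i] is the time from which machine [i] is idle. The jobs of the queue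
   [s] are started in order, each one on a machine of [M] that becomes idle
   first (ties are broken arbitrarily); [C j] is the completion time of [j]. *)
Fixpoint fcfs (R : realType) (K : finType) (J : finType) (p : J -> R)
    (M : {set K}) (C : J -> R) (idle : K -> R) (s : seq J) : Prop :=
  if s is j :: s' then
    exists i : K, [/\ i \in M,
      forall i', i' \in M -> idle i <= idle i',
      C j = idle i + p j &
      fcfs p M C [eta idle with i |-> C j] s']
  else True.

(* Execution of the batch [X] on the machines of [M], starting at time [t];
   the order in which the jobs of [X] are queued is arbitrary. *)
Definition batch_execution (R : realType) (K : finType) (J : finType)
    (c : {set J} -> R) (p : J -> R) (t : R) (X : {set J}) (M : {set K})
    (C : J -> R) : Prop :=
  exists s : seq J,
    perm_eq s (enum X) /\ fcfs p M C (fun=> t + c X) s.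

Definition makespan (R : realType) (J : finType) (C : J -> R) : R :=
  \big[Num.max/0]_(j : J) C j.

Definition max_setup (R : realType) (k : nat) (J : finType)
    (c : {set J} -> R) (f : {ffun J -> 'I_k}) : R :=
  \big[Num.max/0]_(i < k) c (part f i).

Definition floor_sqrt (R : realType) (m : nat) : nat :=
  Num.truncn (Num.sqrt (m%:R : R)).

(* The decisions of the algorithm: the batches [part f i] and the machines
   [M i] assigned to them. They do not depend on the execution times. *)
Definition sqrt_plan (R : realType) (m : nat) (J : finType)
    (c : {set J} -> R) (k : nat) (f : {ffun J -> 'I_k})
    (M : 'I_k -> {set 'I_m}) : Prop :=
  [/\ minimizes (max_setup c) f,
      forall i, #|M i| = (m %/ k)%N &
      forall i i', i != i' -> [disjoint M i & M i']].

(* [C] is a possible family of completion times when the algorithm is run. *)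
Definition sqrt_algorithm (R : realType) (m : nat) (J : finType)
    (c : {set J} -> R) (p : J -> R) (C : J -> R) : Prop :=
  exists (f : {ffun J -> 'I_(floor_sqrt R m)})
         (M : 'I_(floor_sqrt R m) -> {set 'I_m}),
    sqrt_plan c f M /\
    forall i, batch_execution c p 0 (part f i) (M i) C.

Definition competitive (R : realType)
    (A : forall (m : nat) (J : finType),
           ({set J} -> R) -> (J -> R) -> (J -> R) -> Prop)
    (rho : nat -> R) : Prop :=
  forall (m : nat) (J : finType) (c : {set J} -> R) (p : J -> R),
    mUETS_instance m c p ->
    forall opt : R, optimal_makespan m c p opt ->
    forall C : J -> R, A m J c p C -> makespan C <= rho m * opt.

(* Main.v *)
(** Let [k = floor (sqrt m)], so [k^2 <= m <= k (k + 2)]. Merging the parts of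
    an optimal partition in groups of [k + 2] consecutive ones gives a partition
    into [k] parts whose setup times are at most [(k + 3) opt] by subadditivity;
    hence so are those of the batches of the algorithm. Each batch is run on
    [m / k >= k] machines and has total execution time at most
    [m opt <= k (k + 2) opt], so list scheduling adds at most
    [(k + 2) opt + opt]. Altogether the makespan is at most
    [(2 k + 6) opt <= 8 sqrt m opt]. *)
Require Import Defs.
From mathcomp Require Import all_boot all_order all_algebra.
From mathcomp Require Import reals.
From mathcomp Require Import zify lra.
Import Order.TTheory GRing.Theory Num.Theory.
Local Open Scope ring_scope.

(* A job starts on a least loaded machine of [M], hence no later than the
   average of the times from which the machines are idle. *)
Lemma fcfs_start_le (R : realType) (K J : finType) (p : J -> R) (M : {set K})
    (C : J -> R) (s : seq J) (idle : K -> R) :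
  (forall j, 0 <= p j) -> fcfs p M C idle s ->
  forall j, j \in s ->
    (C j - p j) *+ #|M| <= \sum_(i in M) idle i + \sum_(j <- s) p j.
Proof.
move=> p_ge0; elim: s idle => [//|j0 s IHs] idle [i [iM imin Cj0 Hs]] j.
rewrite big_cons inE => /orP[/eqP->|js].
  rewrite Cj0 addrK -sumr_const; apply: le_trans (ler_sum _ imin) _.
  by rewrite lerDl addr_ge0 ?sumr_ge0.
(* Starting [j0] raises the idle time of [i] by [p j0] and removes [p j0] from the queue, so the
   right-hand side is invariant. *)
apply: le_trans (IHs _ Hs j js) _.
rewrite (bigD1 i iM) [X in _ <= X + _](bigD1 i iM) /= eqxx Cj0.
rewrite (eq_bigr idle) => [|i' /andP[_ /negbTE->]//].
lra.
Qed.

Lemma batch_completion_le (R : realType) (K J : finType) (c : {set J} -> R)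
    (p : J -> R) (t : R) (X : {set J}) (M : {set K}) (C : J -> R) :
  (forall j, 0 <= p j) -> batch_execution c p t X M C ->
  forall j, j \in X ->
    (C j - p j - (t + c X)) *+ #|M| <= \sum_(j in X) p j.
Proof.
move=> p_ge0 [s [sX Hs]] j jX.
have js : j \in s by rewrite (perm_mem sX) mem_enum.
have := @fcfs_start_le R K J p M C s _ p_ge0 Hs j js.
rewrite (perm_big _ sX) big_enum /= sumr_const mulrnBl; lra.
Qed.

(** The upper bound on [m] is [m < (k + 1)^2 = k (k + 2) + 1], read over the integers. *)
Lemma floor_sqrt_bounds (R : realType) (m : nat) (k := floor_sqrt R m) :
  (0 < m)%N ->
  [/\ (0 < k)%N, (k * k <= m)%N, (m <= k * k.+2)%N &
      k%:R <= Num.sqrt (m%:R : R)].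
Proof.
move=> m_gt0.
have /andP[k_le k_gt] := Num.Theory.truncn_itv (sqrtr_ge0 (m%:R : R)).
rewrite -/(floor_sqrt R m) -/k in k_le k_gt.
have sq : Num.sqrt (m%:R : R) * Num.sqrt m%:R = m%:R.
  by rewrite -expr2 sqr_sqrtr.
have kk : (k * k <= m)%N by rewrite -(ler_nat R) natrM -sq ler_pM.
have mk : (m < k.+1 * k.+1)%N.
  by rewrite -(ltr_nat R) natrM -sq ltr_pM ?sqrtr_ge0.
split=> //; nia.
Qed.

Section PartitionBounds.
Variables (R : realType) (m : nat) (J : finType).
Variables (c : {set J} -> R) (p : J -> R) (fo : {ffun J -> 'I_m}).
Hypothesis inst : mUETS_instance m c p.
Local Notation opt := (partition_makespan c p fo).

Lemma part_cost_le_makespan i :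
  c (part fo i) + \sum_(j in part fo i) p j <= opt.
Proof. exact: le_bigmax. Qed.

Lemma part_work_ge0 i : 0 <= \sum_(j in part fo i) p j.
Proof. by apply: sumr_ge0 => j _; exact: exec_ge0 inst j. Qed.

Lemma setup_le_makespan i (X : {set J}) : X \subset part fo i -> c X <= opt.
Proof.
move=> /(setup_mono inst) cX.
have := part_cost_le_makespan i; have := part_work_ge0 i; lra.
Qed.

Lemma exec_le_makespan j : p j <= opt.
Proof.
have := part_cost_le_makespan (fo j).
rewrite (bigD1 j) ?inE //=.
have := setup_ge0 inst (part fo (fo j)).
have : 0 <= \sum_(i in part fo (fo j) | i != j) p i.
  by apply: sumr_ge0 => i _; exact: exec_ge0 inst i.
lra.
Qed.

Lemma total_work_le_makespan : \sum_j p j <= opt *+ m.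
Proof.
rewrite (partition_big fo predT) //= -[X in _ *+ X]card_ord -sumr_const.
apply: ler_sum => i _.
rewrite (eq_bigl (mem (part fo i))) => [|j]; last by rewrite !inE.
have := part_cost_le_makespan i; have := setup_ge0 inst (part fo i); lra.
Qed.

(** Subadditivity adds one [opt] per part. The extra one comes from [l = 0]: [c set0] may be
    positive, and is only known to be at most [opt]. *)
Lemma setup_consecutive_parts (a l : nat) :
  c [set j | (a <= fo j < a + l)%N] <= opt *+ l.+1.
Proof.
have le_opt b (X : {set J}) : (forall j, j \in X -> fo j = b :> nat) ->
    c X <= opt.
  move=> Xb; have [b_lt|b_ge] := ltnP b m.
    apply: (@setup_le_makespan (Ordinal b_lt)); apply/subsetP => j /Xb fojb.
    by rewrite inE -val_eqE /= fojb.
  (* No part has index [b >= m], so [X] is empty and lies in part 0. *)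
  have m_gt0 : (0 < m)%N := ltnW (machines_ge2 inst).
  apply: (@setup_le_makespan (Ordinal m_gt0)); apply/subsetP => j /Xb.
  have := ltn_ord (fo j); lia.
elim: l => [|l IHl].
  by apply: (le_opt a) => j; rewrite inE; lia.
have -> : [set j | (a <= fo j < a + l.+1)%N] =
    [set j | (a <= fo j < a + l)%N] :|: [set j | fo j == (a + l)%N :> nat].
  by apply/setP=> j; rewrite !inE; lia.
rewrite mulrSr; apply: le_trans (setup_subadd inst _) _.
  rewrite -setI_eq0; apply/eqP/setP=> j; rewrite !inE; lia.
apply: lerD IHl _; apply: (le_opt (a + l)%N) => j; rewrite inE => /eqP //.
Qed.

Lemma max_setup_merge (k d : nat) (f : {ffun J -> 'I_k}) :
  (m <= k * d)%N -> minimizes (max_setup c) f ->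
  max_setup c f <= opt *+ d.+1.
Proof.
move=> m_le fmin.
have d_gt0 : (0 < d)%N by have := machines_ge2 inst; case: d m_le; lia.
have lt_k (j : J) : (fo j %/ d < k)%N.
  by rewrite ltn_divLR //; exact: leq_trans (ltn_ord _) m_le.
(* Part [a] of [g] is the union of the parts of [fo] with indices from [a * d] to
   [a * d + d - 1]. *)
pose g : {ffun J -> 'I_k} := [ffun j => Ordinal (lt_k j)].
have opt_ge0 : 0 <= opt by exact: bigmax_ge_id.
apply: le_trans (fmin g) _; apply: bigmax_le => [|a _]; first exact: mulrn_wge0.
apply: le_trans (setup_consecutive_parts (a * d) d).
apply: (setup_mono inst); apply/subsetP => j.
rewrite !inE ffunE -val_eqE /= => /eqP <-.
by rewrite leq_trunc_div /= -mulSnr ltn_ceil.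
Qed.

End PartitionBounds.

Theorem theorem8 (R : realType) :
  exists C : R,
    competitive (@sqrt_algorithm R) (fun m : nat => C * Num.sqrt (m%:R : R)).
Proof.
exists 8 => m J c p inst _ [fo [_ ->]] C [f [M [[fmin cardM _] exe]]].
have [k_gt0 kk_le m_le k_sqrt] :=
  @floor_sqrt_bounds R m (ltnW (machines_ge2 inst)).
set k := floor_sqrt R m in f M fmin cardM exe k_gt0 kk_le m_le k_sqrt *.
set opt := partition_makespan c p fo.
have opt_ge0 : 0 <= opt by exact: bigmax_ge_id.
have p_ge0 := exec_ge0 inst.
apply: bigmax_le => [|j _]; first by rewrite !mulr_ge0 ?sqrtr_ge0.
have M_ge : (k <= #|M (f j)|)%N by rewrite cardM leq_divRL.
have jX : j \in part f (f j) by rewrite inE.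
have wait := @batch_completion_le R _ J c p 0 _ _ C p_ge0 (exe (f j)) j jX.
have setup : c (part f (f j)) <= opt *+ k.+3.
  apply: le_trans (max_setup_merge R m J c p fo inst k k.+2 f m_le fmin).
  exact: le_bigmax.
(* The factor [k] is kept apart, to be cancelled against the at least [k] machines of the batch. *)
have work : \sum_(i in part f (f j)) p i <= opt *+ k.+2 *+ k.
  apply: (@le_trans _ _ (\sum_i p i)).
    by rewrite [leRHS](bigID (mem (part f (f j)))) /= lerDl sumr_ge0.
  apply: le_trans (total_work_le_makespan R m J c p fo inst) _.
  by rewrite -mulrnA ler_wpMn2l 1?mulnC.
have delay : C j - p j - (0 + c (part f (f j))) <= opt *+ k.+2.
  set x := C j - p j - _ in wait *.
  (* Replacing [#|M (f j)|] by the smaller [k] requires [x] to be nonnegative. *)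
  have [x_le0|x_gt0] := leP x 0.
    by apply: le_trans x_le0 _; rewrite mulrn_wge0.
  suff: x *+ k <= opt *+ k.+2 *+ k by rewrite lerMn2r eqn0Ngt k_gt0.
  apply: le_trans (le_trans wait work).
  by rewrite ler_wpMn2l // ltW.
have pj := exec_le_makespan R m J c p fo inst j.
rewrite -/opt in pj.
have le8 : opt *+ (8 * k) <= 8 * Num.sqrt m%:R * opt.
  by rewrite -[opt *+ _]mulr_natl natrM ler_wpM2r // ler_wpM2l.
apply: le_trans le8.
(* The summands bound the setup, the wait and [p j]; [2 k + 6 <= 8 k] since [k >= 1]. *)
apply: (@le_trans _ _ (opt *+ (k.+3 + k.+2 + 1))); first by rewrite !mulrnDr; lra.
by apply: ler_wpMn2l => //; lia.
Qed.
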